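(* Let $\mathcal{C}$ be a type I self-dual Weyl tensor and let $\Psi_0,\dots,\Psi_4$ be its components in a non transverse null bivector base $\{\mathbf{W},\mathbf{U},\mathbf{V}\}$. Put $$I = \Psi_0\Psi_4-4\Psi_1\Psi_3+3\Psi_2^2,\qquad J=\begin{vmatrix}\Psi_4&\Psi_3&\Psi_2\\ \Psi_3&\Psi_2&\Psi_1\\ \Psi_2&\Psi_1&\Psi_0\end{vmatrix},\qquad \beta=\sqrt[3]{J+\sqrt{J^2-I^3/27}},$$ where $\beta$ is a particular non-zero value of this root, $$\alpha_1=\beta+\frac{I}{3\beta},\qquad \alpha_2=-\tfrac12\Big((1-\mathrm{i}\sqrt3)\beta+(1+\mathrm{i}\sqrt3)\frac{I}{3\beta}\Big),\qquad \alpha_3=-\tfrac12\Big((1+\mathrm{i}\sqrt3)\beta+(1-\mathrm{i}\sqrt3)\frac{I}{3\beta}\Big),$$ and, for $i=1,2,3$, $$A_i=\Psi_0\Psi_4+\Psi_2^2-2\Psi_1\Psi_3+\alpha_i\Psi_2+(\alpha_i^2-I),\qquad B_i=\Psi_1\Psi_4-\Psi_2\Psi_3+\Psi_3\alpha_i,$$ $$C_i=2\Psi_2\Psi_4-2\Psi_3^2+\alpha_i\Psi_4,\qquad D_i=\tfrac12(I-3\alpha_i^2).$$ Then the (unitary) principal 2-forms $\mathbf{W}_i$ of $\mathcal{C}$ are given by $$\mathbf{W}_i=\frac{1}{\sqrt{D_iC_i}}\big(A_i\mathbf{U}+B_i\mathbf{W}+C_i\mathbf{V}\big),\qquad i=1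,2,3.$$
   Context: Everything is pointwise on an oriented, time-oriented 4-dimensional spacetime with metric $g$ of signature $(-+++)$ and volume element $\eta$. Self-dual 2-forms. $X$ is self-dual if $*X=\mathrm{i}X$, $*$ the Hodge dual. On the 3-dimensional complex space of self-dual 2-forms use the metric $(X,Y)=\frac12X_{\alpha\beta}Y^{\alpha\beta}$, i.e. the metric $\mathcal{G}=\frac12(G-\mathrm{i}\eta)$, $G$ being the usual metric on 2-forms. A unitary self-dual 2-form satisfies $(X,X)=-1$. Also $a\wedge b=a\otimes b-b\otimes a$. Weyl tensor. The self-dual Weyl tensor is $\mathcal{C}=\frac12(C-\mathrm{i}*C)$, $C$ the Weyl tensor, regarded as a trace-free, $(\cdot,\cdot)$-symmetric endomorphism of the space of self-dual 2-forms; $(A\otimes B)(X)=A\,(B,X)$. Its characteristic equation is $x^3-Ix-2J=0$ with $I=\frac12\operatorname{tr}\mathcal{C}^2$, $J=\frac16\operatorname{tr}\mathcal{C}^3$. Type I means that the three roots $\alpha_1,\alpha_2,\alpha_3$ are distinct, equivalently $27J^2\neq I^3$. Then there are unitary, mutually orthogonal eigenvectors $\mathbf{W}_i$, $\mathcal{C}(\mathbf{W}_i)=\alpha_i\mathbf{W}_i$, called principal 2-forms, unique up to sign, with $\mathcal{C}=-\sum_i\alpha_i\mathbf{W}_i\otimes\mathbf{W}_i$. Null frames and components. A null tetrad $\{l,k,m,\bar m\}$ has $l,k$ real future-pointing null vectors, $m$ complex null, $l\cdot k=-1$, $m\cdot\bar m=1$, other products zero. Its associated null bivector base is $\mathbf{W}=\frac1{\sqrt2}(l\wedge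 k+m\wedge\bar m)$, $\mathbf{U}=-\frac1{\sqrt2}l\wedge\bar m$, $\mathbf{V}=\frac1{\sqrt2}k\wedge m$, the tetrad being oriented so that these are self-dual (so $(\mathbf{W},\mathbf{W})=-1$, $(\mathbf{U},\mathbf{V})=\frac12$, other products zero). The components $\Psi_a$ are defined by $$\tfrac12\mathcal{C}=\Psi_0\mathbf{U}\otimes\mathbf{U}+\Psi_1\mathbf{U}\tilde\otimes\mathbf{W}+\Psi_2(\mathbf{U}\tilde\otimes\mathbf{V}+\mathbf{W}\otimes\mathbf{W})+\Psi_3\mathbf{W}\tilde\otimes\mathbf{V}+\Psi_4\mathbf{V}\otimes\mathbf{V},$$ with $A\tilde\otimes B=A\otimes B+B\otimes A$. The base (or tetrad) is transverse if $\Psi_1=\Psi_3=0$, and non transverse otherwise. (The roman $\mathrm{i}$ is the imaginary unit; the italic subscript $i$ is an index.)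
   Formalization: The formula for W_i is asserted only for those i with C_i ≠ 0; a non transverse base can have A_i = B_i = C_i = 0 (e.g. Ψ4=Ψ3=1, Ψ2=0, Ψ1=−2, generic Ψ0, α_i=2), where it reads 0/0. *)

(* Defs.v *)
From HB Require Import structures.
From mathcomp Require Import all_boot all_order all_algebra.
From mathcomp Require Import reals complex.

Set Implicit Arguments.
Unset Strict Implicit.
Unset Printing Implicit Defensive.

Import Order.TTheory GRing.Theory Num.Theory.
Local Open Scope ring_scope.
Local Open Scope complex_scope.

(* The tangent space at a point is R^4 through an arbitrary basis: vectors are
   row vectors of (upper-index) components, and the metric is the matrix g of
   its (lower-index) components in that basis.  A 2-tensor is the matrix of its
   lower-index components. *)

Definition dot (K : comPzRingType) (n : nat) (g : 'M[K]_n) (u v : 'rV[K]_n) : K :=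
  (u *m g *m v^T) 0 0.

(* Signature (-+++): the rows of P form an orthonormal basis. *)
Definition lorentzian (R : realType) (g : 'M[R]_4) : Prop :=
  exists2 P : 'M[R]_4, P \in unitmx &
    P *m g *m P^T = diag_mx (\row_(j < 4) (if j == 0 then -1 else 1)).

Definition cplx_mx (R : realType) (m n : nat) (A : 'M[R]_(m, n)) :
    'M[R[i]]_(m, n) :=
  map_mx (real_complex R) A.

Definition tensor4 (K : Type) : Type := 'I_4 -> 'I_4 -> 'I_4 -> 'I_4 -> K.

Definition levi_civita (K : comNzRingType) : tensor4 K := fun a b c d =>
  \det (\matrix_(i < 4, j < 4) ((tnth [tuple a; b; c; d] i == j)%:R : K)).

(* The orientation is the boolean o: it is false when the coordinate basis is
   positively oriented, and true otherwise. *)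
Definition volume_element (R : realType) (g : 'M[R]_4) (o : bool) : tensor4 R :=
  fun a b c d => (-1) ^+ o * Num.sqrt (- \det g) * levi_civita R a b c d.

Definition raise (R : realType) (g : 'M[R]_4) (X : 'M[R[i]]_4) : 'M[R[i]]_4 :=
  cplx_mx (invmx g) *m X *m (cplx_mx (invmx g))^T.

(* ( *X)_{ab} = 1/2 eta_{abcd} X^{cd} *)
Definition hodge (R : realType) (g : 'M[R]_4) (o : bool) (X : 'M[R[i]]_4) :
    'M[R[i]]_4 :=
  \matrix_(a < 4, b < 4)
    (2^-1 * \sum_(c < 4) \sum_(d < 4)
              (volume_element g o a b c d)%:C * raise g X c d).

Definition self_dual (R : realType) (g : 'M[R]_4) (o : bool)
    (X : 'M[R[i]]_4) : Prop :=
  X^T = - X /\ hodge g o X = ('i : R[i])%R *: X.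

(* (X, Y) = 1/2 X_{ab} Y^{ab} *)
Definition ip (R : realType) (g : 'M[R]_4) (X Y : 'M[R[i]]_4) : R[i] :=
  2^-1 * \sum_(a < 4) \sum_(b < 4) X a b * raise g Y a b.

Definition weyl_tensor (R : realType) (g : 'M[R]_4) (C : tensor4 R) : Prop :=
  [/\ forall a b c d, C b a c d = - C a b c d,
      forall a b c d, C c d a b = C a b c d,
      forall a b c d, C a b c d + C a c d b + C a d b c = 0
    & forall b d, \sum_(a < 4) \sum_(c < 4) invmx g a c * C a b c d = 0].

(* 1/2 (C - i *C), the dual being taken on the first pair of indices; for a
   Weyl tensor this is the same as the dual on the second pair. *)
Definition self_dual_weyl (R : realType) (g : 'M[R]_4) (o : bool)
    (C : tensor4 R) : tensor4 R[i] :=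
  fun a b c d =>
    2^-1 * ((C a b c d)%:C
            - 'i%R * hodge g o (\matrix_(p < 4, q < 4) (C p q c d)%:C) a b).

(* X |-> 1/2 T_{abcd} X^{cd} *)
Definition endo (R : realType) (g : 'M[R]_4) (T : tensor4 R[i])
    (X : 'M[R[i]]_4) : 'M[R[i]]_4 :=
  \matrix_(a < 4, b < 4) ip g (\matrix_(c < 4, d < 4) T a b c d) X.

(* The traces are taken over the space of all 2-tensors.  The endomorphism of a
   self-dual Weyl tensor takes its values in the self-dual 2-forms, so that
   these are the traces of its restriction to the self-dual 2-forms. *)
Definition invariant_I (R : realType) (g : 'M[R]_4) (T : tensor4 R[i]) : R[i] :=
  2^-1 * \tr (lin_mx (endo g T \o endo g T)).

Definition invariant_J (R : realType) (g : 'M[R]_4) (T : tensor4 R[i]) : R[i] :=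
  6^-1 * \tr (lin_mx (endo g T \o endo g T \o endo g T)).

Definition characteristic_poly (R : realType) (g : 'M[R]_4)
    (T : tensor4 R[i]) : {poly R[i]} :=
  'X^3 - invariant_I g T *: 'X - (2 * invariant_J g T)%:P.

Definition type_I (R : realType) (g : 'M[R]_4) (T : tensor4 R[i]) : Prop :=
  exists2 r : 'I_3 -> R[i],
    injective r & forall i, root (characteristic_poly g T) (r i).

Definition tens (K : pzRingType) (A B : 'M[K]_4) : tensor4 K :=
  fun a b c d => A a b * B c d.

Definition symtens (K : pzRingType) (A B : 'M[K]_4) : tensor4 K :=
  fun a b c d => tens A B a b c d + tens B A a b c d.

(* The 2-form a /\ b obtained by lowering the indices of the vectors a, b. *)
Definition wedge (R : realType) (g : 'M[R]_4) (a b : 'rV[R[i]]_4) :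
    'M[R[i]]_4 :=
  let a' := a *m cplx_mx g in
  let b' := b *m cplx_mx g in
  a'^T *m b' - b'^T *m a'.

Definition conj_mx (R : realType) (m n : nat) (A : 'M[R[i]]_(m, n)) :
    'M[R[i]]_(m, n) :=
  map_mx Num.conj A.

(* The time orientation is given by a timelike vector t. *)
Definition future_pointing (R : realType) (g : 'M[R]_4) (t v : 'rV[R]_4) : Prop :=
  dot g v t < 0.

Definition null_tetrad (R : realType) (g : 'M[R]_4) (t l k : 'rV[R]_4)
    (m : 'rV[R[i]]_4) : Prop :=
  [/\ [/\ future_pointing g t l, future_pointing g t k,
          dot g l l = 0, dot g k k = 0 & dot g l k = -1],
      [/\ dot (cplx_mx g) m m = 0,
          dot (cplx_mx g) (conj_mx m) (conj_mx m) = 0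
        & dot (cplx_mx g) m (conj_mx m) = 1],
      dot (cplx_mx g) (cplx_mx l) m = 0
        /\ dot (cplx_mx g) (cplx_mx l) (conj_mx m) = 0
    & dot (cplx_mx g) (cplx_mx k) m = 0
        /\ dot (cplx_mx g) (cplx_mx k) (conj_mx m) = 0].

Definition null_bivector_base (R : realType) (g : 'M[R]_4) (o : bool)
    (t : 'rV[R]_4) (W U V : 'M[R[i]]_4) : Prop :=
  exists (l k : 'rV[R]_4) (m : 'rV[R[i]]_4),
    [/\ null_tetrad g t l k m,
        W = (sqrtC 2)^-1 *: (wedge g (cplx_mx l) (cplx_mx k)
                             + wedge g m (conj_mx m)),
        U = - (sqrtC 2)^-1 *: wedge g (cplx_mx l) (conj_mx m),
        V = (sqrtC 2)^-1 *: wedge g (cplx_mx k) m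
      & [/\ self_dual g o W, self_dual g o U & self_dual g o V]].

Definition weyl_components (K : fieldType) (T : tensor4 K) (W U V : 'M[K]_4)
    (Psi0 Psi1 Psi2 Psi3 Psi4 : K) : Prop :=
  forall a b c d,
    2^-1 * T a b c d =
      Psi0 * tens U U a b c d + Psi1 * symtens U W a b c d
      + Psi2 * (symtens U V a b c d + tens W W a b c d)
      + Psi3 * symtens W V a b c d + Psi4 * tens V V a b c d.

Definition transverse (K : pzRingType) (Psi1 Psi3 : K) : Prop :=
  Psi1 = 0 /\ Psi3 = 0.

Definition principal_2forms (R : realType) (g : 'M[R]_4) (o : bool)
    (T : tensor4 R[i]) (alpha : 'I_3 -> R[i]) (Wp : 'I_3 -> 'M[R[i]]_4) : Prop :=
  [/\ forall i, self_dual g o (Wp i),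
      forall i, ip g (Wp i) (Wp i) = -1,
      forall i j, i != j -> ip g (Wp i) (Wp j) = 0,
      forall i, endo g T (Wp i) = alpha i *: Wp i
    & forall a b c d,
        T a b c d = - \sum_(i < 3) alpha i * tens (Wp i) (Wp i) a b c d].

(* Main.v *)
Require Import Defs.
From HB Require Import structures.
From mathcomp Require Import all_boot all_order all_algebra.
From mathcomp Require Import reals complex ring.

Set Implicit Arguments.
Unset Strict Implicit.
Unset Printing Implicit Defensive.

Import Order.TTheory GRing.Theory Num.Theory.
Local Open Scope ring_scope.

(** In the basis (U, W, V) let G and S be the symmetric matrices of the inner
    product and of C.  Then C acts on row vectors as M = (S G)^T, whose
    characteristic polynomial x^3 - I x - 2 J is split by Cardano's formula.
    By Cayley-Hamilton M^2 + alpha_i M + (alpha_i^2 - I) is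
    (M - alpha_j) (M - alpha_k), the projection onto the i-th eigenline up to
    the factor -2 D_i; its value on U is A_i U + B_i W + C_i V, of square norm
    -D_i C_i.  When C_i = 0 that value vanishes, but the value on W does not.
    Orthogonality of the eigenrows and completeness are matrix algebra.
    Uniqueness requires that U, W, V span the self-dual 2-forms: together with
    their conjugates, which are anti-self-dual, they span all 2-forms. *)

(** * Simultaneous diagonalization *)

Section Diagonalization.
Variables (K : fieldType) (n : nat).
Implicit Types (G M N S : 'M[K]_n) (al : 'I_n -> K).

Lemma mul_diag_entry al N i j :
  (diag_mx (\row_k al k) *m N) i j = al i * N i j.
Proof. by rewrite mul_diag_mx !mxE. Qed.

(** As [M *m G] is symmetric, so is the diagonal matrix times [A = N *m G *m N^T]. Comparing its
    entries at (i, j) and (j, i) gives [al j * A i j = al i * A i j]. *)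
Lemma eigenrows_orthogonal al G M N :
  injective al -> G^T = G -> (M *m G)^T = M *m G ->
  N *m M = diag_mx (\row_k al k) *m N ->
  forall i j, i != j -> (N *m G *m N^T) i j = 0.
Proof.
move=> alI Gs MGs NM i j nij.
set A := N *m G *m N^T.
have As : A^T = A by rewrite /A !trmx_mul trmxK Gs mulmxA.
have Aji : A j i = A i j by rewrite -[in RHS]As [RHS]mxE.
have DAs : (diag_mx (\row_k al k) *m A)^T = diag_mx (\row_k al k) *m A.
  by rewrite /A !mulmxA -NM -(mulmxA N M) 2!trmx_mul trmxK MGs mulmxA.
have /eqP : al j * A i j = al i * A i j.
  by rewrite -mul_diag_entry -DAs [RHS]mxE mul_diag_entry Aji.
rewrite -subr_eq0 -mulrBl mulf_eq0 subr_eq0 => /orP [/eqP /alI jE|/eqP //].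
by case/eqP: nij.
Qed.

(** The normalization makes [- G *m N^T] a two-sided inverse of [N], hence
    [N^T *m N *m G^T = - 1%:M]. Multiplying the eigenrow equation by [N^T] on the left then isolates
    [S^T]. *)
Lemma spectral_decomposition al G S N :
  N *m G *m N^T = - 1%:M ->
  N *m (S *m G)^T = diag_mx (\row_k al k) *m N ->
  S = - (N^T *m diag_mx (\row_k al k) *m N).
Proof.
move=> NG NM.
have /mulmx1C GN : N *m (- G *m N^T) = 1%:M.
  by rewrite mulmxA mulmxN mulNmx NG opprK.
have NNG : N^T *m N *m G^T = - 1%:M.
  have := congr1 trmx GN.
  by rewrite !trmx_mul trmxK trmx1 linearN /= !mulmxN mulmxA => /eqP;
    rewrite eqr_oppLR => /eqP.
have := congr1 (mulmx N^T) NM.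
rewrite trmx_mul !mulmxA NNG mulNmx mul1mx => /eqP; rewrite eqr_oppLR => /eqP.
move/(congr1 trmx); rewrite trmxK => ->.
by rewrite linearN /= !trmx_mul trmxK tr_diag_mx mulmxA.
Qed.

(** In the basis formed by the rows of [N], [x] becomes an eigenrow of a diagonal matrix with
    distinct entries, so only its i-th coordinate survives; the norm condition makes that coordinate
    square to 1. *)
Lemma unit_eigenrow_uniq al G M N (x : 'rV[K]_n) i :
  injective al ->
  N *m G *m N^T = - 1%:M ->
  N *m M = diag_mx (\row_k al k) *m N ->
  x *m M = al i *: x -> x *m G *m x^T = - 1%:M ->
  x = row i N \/ x = - row i N.
Proof.
move=> alI NG NM xM xG.
have NK : N *m (- G *m N^T) = 1%:M.
  by rewrite mulmxA mulmxN mulNmx NG opprK.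
have [Nu _] := mulmx1_unit NK.
have [y xE] : exists y, x = y *m N by exists (x *m invmx N); rewrite mulmxKV.
have yD : y *m diag_mx (\row_k al k) = al i *: y.
  by rewrite -[LHS](mulmxK Nu) -(mulmxA y) -NM mulmxA -xE xM -scalemxAl xE
    mulmxK.
have y0 j : j != i -> y 0 j = 0.
  move=> nji; have /eqP := congr1 (fun B : 'rV_n => B 0 j) yD.
  rewrite mul_mx_diag !mxE mulrC -subr_eq0 -mulrBl mulf_eq0 subr_eq0.
  by case/orP => [/eqP /alI jE|/eqP //]; rewrite jE eqxx in nji.
have xy : x = y 0 i *: row i N.
  rewrite xE mulmx_sum_row (bigD1 i) //= big1 ?addr0 // => j /y0 ->.
  by rewrite scale0r.
have : y 0 i ^+ 2 == 1.
  move/matrixP/(_ 0 0): xG; rewrite xE trmx_mul !mulmxA -(mulmxA y) -(mulmxA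
    y) NG.
  rewrite mulmxN mulmx1 mulNmx !mxE eqxx (bigD1 i) //= big1 ?addr0.
    by rewrite mxE => /oppr_inj y1; rewrite expr2 y1.
  by move=> j /y0 ->; rewrite mul0r.
rewrite sqrf_eq1 => /orP [/eqP y1|/eqP y1]; [left|right].
  by rewrite xy y1 scale1r.
by rewrite xy y1 scaleN1r.
Qed.

End Diagonalization.

(** [lin_mx f] records only the values of [f] at the unit matrices, so composites of [endo] can be
    handled without giving them a linear structure. *)
Lemma lin_mxP (K : comNzRingType) m n p q (f : 'M[K]_(m, n) -> 'M[K]_(p, q)) B :
  (forall X, mxvec (f X) = mxvec X *m B) -> lin_mx f = B.
Proof.
move=> fB; apply/row_matrixP => i.
by rewrite !rowE -[RHS](congr1 (mulmx^~ B) (vec_mxK _)) -fB; apply/rowP => j;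
  rewrite -rowE !mxE.
Qed.

(** * The Weyl endomorphism in components *)

Definition mx3 (K : nmodType) (rows : seq (seq K)) : 'M[K]_3 :=
  \matrix_(i, j) (nth [::] rows i)`_j.

Definition rv3 (K : nmodType) (x y z : K) : 'rV[K]_3 :=
  \row_j [:: x; y; z]`_j.

Lemma ord3P (P : 'I_3 -> Prop) :
  P 0 -> P 1 -> P 2%:R -> forall i, P i.
Proof.
move=> P0 P1 P2 [[|[|[|//]]] lt3].
- by rewrite (_ : Ordinal lt3 = 0) //; apply: val_inj.
- by rewrite (_ : Ordinal lt3 = 1) //; apply: val_inj.
- by rewrite (_ : Ordinal lt3 = 2%:R) //; apply: val_inj.
Qed.

Section Coordinates.
Variables (K : numFieldType) (p0 p1 p2 p3 p4 a : K).

Definition gram3 : 'M[K]_3 :=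
  mx3 [:: [:: 0; 0; 2^-1]; [:: 0; -1; 0]; [:: 2^-1; 0; 0]].

(* The rows and columns are those of U, W, V, in this order. *)
Definition weyl3 : 'M[K]_3 :=
  2 *: mx3 [:: [:: p0; p1; p2]; [:: p1; p2; p3]; [:: p2; p3; p4]].

Definition weyl_I : K := p0 * p4 - 4 * p1 * p3 + 3 * p2 ^+ 2.
Definition weyl_J : K :=
  p4 * (p2 * p0 - p1 ^+ 2) - p3 * (p3 * p0 - p1 * p2)
  + p2 * (p1 * p3 - p2 ^+ 2).

Definition eigA := p0 * p4 + p2 ^+ 2 - 2 * p1 * p3 + a * p2 + (a ^+ 2 - weyl_I).
Definition eigB := p1 * p4 - p2 * p3 + p3 * a.
Definition eigC := 2 * p2 * p4 - 2 * p3 ^+ 2 + a * p4.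
Definition eigD := 2^-1 * (weyl_I - 3 * a ^+ 2).

Lemma gram3_tr : gram3^T = gram3.
Proof. by apply/matrixP; do 2!elim/ord3P; rewrite !mxE. Qed.

Lemma weyl3_tr : weyl3^T = weyl3.
Proof. by apply/matrixP; do 2!elim/ord3P; rewrite !mxE. Qed.

Lemma weyl3_gram3E : (weyl3 *m gram3)^T =
  mx3 [:: [:: p2; p3; p4]; [:: -2 * p1; -2 * p2; -2 * p3]; [:: p0; p1; p2]].
Proof.
apply/matrixP; do 2!elim/ord3P; rewrite !mxE !big_ord_recl big_ord0 !mxE /=;
  by field.
Qed.

(** The row is the U-row of E = M^2 + a M + (a^2 - I), and E (M - a) = (M^3 - I M) - (a^3 - I a) = 2
    J - 2 J = 0. *)
Lemma weyl3_eigenrow : a ^+ 3 = weyl_I * a + 2 * weyl_J ->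
  rv3 eigA eigB eigC *m (weyl3 *m gram3)^T = a *: rv3 eigA eigB eigC.
Proof.
rewrite weyl3_gram3E /weyl_I /weyl_J => rt; apply/rowP; elim/ord3P;
  rewrite !mxE !big_ord_recl big_ord0 !mxE /= /eigA /eigB /eigC /weyl_I;
  ring: rt.
Qed.

(** With E as above, self-adjoint, E^2 = (3 a^2 - I) E = -2 D E. Hence (E U, E U) = -2 D (E U, U) =
    -2 D C (V, U) = - D C. *)
Lemma eigABC_norm : a ^+ 3 = weyl_I * a + 2 * weyl_J ->
  eigA * eigC - eigB ^+ 2 = - (eigD * eigC).
Proof.
rewrite /weyl_I /weyl_J /eigA /eigB /eigC /eigD /weyl_I => rt.
by field: rt.
Qed.

(* A vanishing minor of M^2 + a M + (a^2 - I), which has rank one. *)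
Lemma eigA_sqr : a ^+ 3 = weyl_I * a + 2 * weyl_J ->
  eigA ^+ 2 = (2 * p2 * p0 - 2 * p1 ^+ 2 + a * p0) * eigC.
Proof.
rewrite /weyl_I /weyl_J /eigA /eigC /weyl_I => rt.
by ring: rt.
Qed.

(* When eigC = 0, the value of M^2 + a M + (a^2 - I) on W has components
   (eigA', -2 eigD, 0). *)
Definition eigA' := 2 * p1 * p2 - 2 * p0 * p3 - 2 * a * p1.

(** The value on W is divided by -2 D: with W-coordinate 1 and V-coordinate 0 the square norm is -1,
    whatever the U-coordinate. *)
Lemma weyl3_eigenrow0 : a ^+ 3 = weyl_I * a + 2 * weyl_J ->
  eigC = 0 -> eigD != 0 ->
  let x := rv3 (- eigA' / (2 * eigD)) 1 0 in
  x *m (weyl3 *m gram3)^T = a *: x.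
Proof.
move=> rt C0 D0 /=.
have B0 : eigB = 0.
  by apply/eqP; rewrite -sqrf_eq0 -oppr_eq0 -[- _]add0r -{1}[0](mulr0 eigA)
    -{1}C0 eigABC_norm // C0 mulr0 oppr0.
have A0 : eigA = 0 by apply/eqP; rewrite -sqrf_eq0 eigA_sqr // C0 mulr0.
pose y := rv3 eigA' (- 2 * eigD) 0.
have yx : rv3 (- eigA' / (2 * eigD)) 1 0 = - (2 * eigD)^-1 *: y.
  by apply/rowP; elim/ord3P; rewrite !mxE /=; field.
rewrite yx -scalemxAl scalerA [a * _]mulrC -scalerA; congr (_ *: _).
(* The right-hand side is the W-row of M^2 + a M + (a^2 - I) before any simplification. Its middle
   entry differs from -2 D by 2 A, its last one is -2 B, and A = B = 0 here. *)
have yE : y = rv3 eigA' (4 * p2 ^+ 2 - 4 * p1 * p3 - 2 * a * p2 + a ^+ 2 -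
  weyl_I) (- 2 * eigB).
  congr rv3; last by rewrite B0 mulr0.
  by apply/eqP; rewrite -subr_eq0 -[0](mulr0 2) -A0 /eigA /eigD /weyl_I;
    apply/eqP; field.
rewrite yE.
rewrite weyl3_gram3E; move: rt; rewrite /weyl_I /weyl_J => rt; apply/rowP;
  elim/ord3P;
  rewrite !mxE !big_ord_recl big_ord0 !mxE /= /eigA' /eigB /weyl_I;
  ring: rt.
Qed.

End Coordinates.

Lemma det_weyl_J (K : numFieldType) (p0 p1 p2 p3 p4 : K) :
 \det (\matrix_(i < 3, j < 3)
                   tnth (tnth [tuple [tuple p4; p3; p2];
                                     [tuple p3; p2; p1];
                                     [tuple p2; p1; p0]] i) j) =
                                       weyl_J p0 p1 p2 p3 p4.
Proof.
rewrite (expand_det_row _ 0) !big_ord_recl big_ord0 /cofactor.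
rewrite !(expand_det_row _ 0) !big_ord_recl !big_ord0 /cofactor !det_mx11 !mxE
  /=.
rewrite !(tnth_nth 0) /=.
by rewrite /weyl_J; ring.
Qed.

Lemma gram3_rv3 (K : numFieldType) (x y z : K) :
  rv3 x y z *m gram3 K *m (rv3 x y z)^T = (x * z - y ^+ 2)%:M.
Proof.
apply/matrixP => i j; rewrite !ord1 !mxE !big_ord_recl big_ord0 !mxE /=.
rewrite !big_ord_recl !big_ord0 !mxE /=; by field.
Qed.

Lemma tr_weyl3_sqr (K : numFieldType) (p0 p1 p2 p3 p4 : K) :
  let M := (weyl3 p0 p1 p2 p3 p4 *m gram3 K)^T in
  \tr (M *m M) = 2 * weyl_I p0 p1 p2 p3 p4.
Proof.
rewrite /= weyl3_gram3E /mxtrace !big_ord_recl big_ord0 !mxE.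
rewrite !big_ord_recl !big_ord0 !mxE /= /weyl_I; ring.
Qed.

Lemma tr_weyl3_cube (K : numFieldType) (p0 p1 p2 p3 p4 : K) :
  let M := (weyl3 p0 p1 p2 p3 p4 *m gram3 K)^T in
  \tr (M *m M *m M) = 6 * weyl_J p0 p1 p2 p3 p4.
Proof.
rewrite /= weyl3_gram3E /mxtrace !big_ord_recl big_ord0 !mxE.
rewrite !big_ord_recl !big_ord0 !mxE.
rewrite !big_ord_recl !big_ord0 !mxE /= /weyl_J; ring.
Qed.

(** * Cardano's formula for x^3 - I x - 2 J *)

Section Cardano.
Variables (K : numFieldType) (I J r c beta : K).
Hypotheses (cc : c ^+ 2 = - 3) (rr : r ^+ 2 = J ^+ 2 - I ^+ 3 / 27).
Hypotheses (bb : beta ^+ 3 = J + r) (b0 : beta != 0).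

(** As [c] is a square root of -3, the factors - (1 - c) / 2 and - (1 + c) / 2 are the two primitive
    cube roots of unity. *)
Definition cardano (i : 'I_3) : K :=
  [:: beta + I / (3 * beta);
      - 2^-1 * ((1 - c) * beta + (1 + c) * (I / (3 * beta)));
      - 2^-1 * ((1 + c) * beta + (1 - c) * (I / (3 * beta)))]`_i.

Let q := I / (3 * beta).

Let IE : I = 3 * beta * q.
Proof. by rewrite /q; field. Qed.

(** beta^3 q^3 = I^3 / 27 = J^2 - r^2 = (J - r) (J + r), and J + r = beta^3 cancels. *)
Let q3 : q ^+ 3 = J - r.
Proof.
have b30 : beta ^+ 3 != 0 by rewrite expf_neq0.
apply: (mulfI b30); by rewrite [RHS]mulrC [in RHS]bb -subr_sqr rr IE; field.
Qed.

(** With I = 3 beta q and 2 J = beta^3 + q^3 the cubic is x^3 - beta^3 - q^3 - 3 x beta q, which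
    splits into linear factors over the cube roots of unity. *)
Lemma cardano_prod x :
  x ^+ 3 - I * x - 2 * J = \prod_(i < 3) (x - cardano i).
Proof.
have JE : J = 2^-1 * (beta ^+ 3 + q ^+ 3) by rewrite bb q3; field.
rewrite JE !big_ord_recl big_ord0 /cardano /= -/q IE mulr1.
by field: cc.
Qed.

Lemma cardano_root i : cardano i ^+ 3 = I * cardano i + 2 * J.
Proof.
apply/eqP; rewrite -subr_eq0 opprD addrA cardano_prod (bigD1 i) //=.
by rewrite subrr mul0r.
Qed.

(** Both sides are the derivative of the cubic at its i-th root. The left one is -2 D_i, so distinct
    roots give D_i != 0. *)
Lemma cardano_disc i :
  3 * cardano i ^+ 2 - I = \prod_(j < 3 | j != i) (cardano i - cardano j).
Proof.
elim/ord3P: i; rewrite big_mkcond !big_ord_recl big_ord0 /cardano /= -/q IE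
  !mulr1 ?mul1r;
by field: cc.
Qed.

(** Each [s i] is a root, hence equals some [cardano (f i)]. Then [f] is injective on a finite type,
    thus bijective, and injectivity passes from [s] to [cardano]. *)
Lemma cardano_inj (s : 'I_3 -> K) : injective s ->
  (forall i, s i ^+ 3 - I * s i - 2 * J = 0) -> injective cardano.
Proof.
move=> sI sr.
have /fin_all_exists [f fE] i : exists j, s i = cardano j.
  have /eqP := sr i; rewrite cardano_prod => /prodf_eq0 [j _].
  by rewrite subr_eq0 => /eqP ->; exists j.
have fI : injective f by move=> i j fij; apply: sI; rewrite !fE fij.
have [h hK fK] := injF_bij fI.
by move=> i j; rewrite -(fK i) -(fK j) -!fE => /sI ->.
Qed.

End Cardano.

(** * Inner product and Hodge dual *)

Lemma lorentzian_sym (R : realType) (g : 'M[R]_4) : lorentzian g -> g^T = g.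
Proof.
case=> P Pu PgP; have PTu : P^T \in unitmx by rewrite unitmx_tr.
apply: (can_inj (mulKmx Pu)); apply: (can_inj (mulmxK PTu)).
by rewrite PgP -tr_diag_mx -PgP !trmx_mul trmxK mulmxA.
Qed.

Section Forms.
Variables (R : realType) (g : 'M[R]_4) (o : bool).
Implicit Types (X Y : 'M[R[i]]_4).

Lemma ip_tr X Y : ip g X Y = 2^-1 * \tr (X^T *m raise g Y).
Proof.
congr (_ * _); rewrite /mxtrace exchange_big; apply: eq_bigr => a _.
by rewrite mxE; apply: eq_bigr => b _; rewrite [X^T _ _]mxE.
Qed.

Lemma ipDl X Y Z : ip g (X + Y) Z = ip g X Z + ip g Y Z.
Proof. by rewrite !ip_tr linearD mulmxDl linearD mulrDr. Qed.

Lemma ipZl a X Y : ip g (a *: X) Y = a * ip g X Y.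
Proof. by rewrite !ip_tr linearZ -scalemxAl linearZ mulrCA. Qed.

Lemma ip_linear_r X : linear (ip g X : 'M_4 -> R[i]^o).
Proof.
move=> a Y Z; rewrite !ip_tr /raise mulmxDr mulmxDl -scalemxAr -scalemxAl.
by rewrite mulmxDr -scalemxAr linearP mulrDr mulrCA.
Qed.

Lemma hodge_linear : linear (hodge g o).
Proof.
move=> a X Y; apply/matrixP => p q; rewrite !mxE mulrCA -mulrDr; congr (_ * _).
rewrite mulr_sumr -big_split; apply: eq_bigr => c _.
rewrite mulr_sumr -big_split; apply: eq_bigr => d _ /=.
rewrite /raise mulmxDr mulmxDl -scalemxAr -scalemxAl mxE [X in _ * (X + _)]mxE.
by rewrite mulrDr mulrCA.
Qed.

HB.instance Definition _ X :=
  GRing.isLinear.Build R[i] 'M[R[i]]_4 R[i]^o _ (ip g X) (ip_linear_r X).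
HB.instance Definition _ :=
  GRing.isLinear.Build R[i] 'M[R[i]]_4 'M[R[i]]_4 _ (hodge g o) hodge_linear.

Lemma ipDr X Y Z : ip g X (Y + Z) = ip g X Y + ip g X Z.
Proof. exact: linearD. Qed.

Lemma ipZr a X Y : ip g X (a *: Y) = a * ip g X Y.
Proof. exact: linearZ. Qed.

Lemma ip_sumZl n (x : 'I_n -> R[i]) (F : 'I_n -> 'M_4) Y :
  ip g (\sum_p x p *: F p) Y = \sum_p x p * ip g (F p) Y.
Proof.
have ip0 : ip g 0 Y = 0 by rewrite ip_tr trmx0 mul0mx mxtrace0 mulr0.
apply: (big_rec2 (fun X z => ip g X Y = z)) => // p z X _ <-.
by rewrite ipDl ipZl.
Qed.

Lemma ip_sumZr n (x : 'I_n -> R[i]) (F : 'I_n -> 'M_4) Y :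
  ip g Y (\sum_p x p *: F p) = \sum_p x p * ip g Y (F p).
Proof. by rewrite linear_sum; apply: eq_bigr => p _; rewrite linearZ. Qed.

Lemma conj_cplx_mx m n (A : 'M[R]_(m, n)) : conj_mx (cplx_mx A) = cplx_mx A.
Proof. by apply/matrixP => i j; rewrite mxE [LHS]/= !mxE;
  apply: conjc_real. Qed.

Lemma raise_conj X : raise g (conj_mx X) = conj_mx (raise g X).
Proof.
by rewrite /raise /conj_mx !map_mxM -map_trmx -!/(conj_mx _) conj_cplx_mx.
Qed.

(** The metric and the volume element are real. Conjugation therefore exchanges the eigenvalues i
    and -i of the dual. *)
Lemma hodge_conj X : hodge g o (conj_mx X) = conj_mx (hodge g o X).
Proof.
apply/matrixP => p q; rewrite [LHS]mxE [RHS]mxE [in RHS]mxE raise_conj.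
rewrite rmorphM fmorphV rmorph_nat rmorph_sum.
congr (_ * _); apply: eq_bigr => c _; rewrite rmorph_sum; apply: eq_bigr => d _.
rewrite [RHS]rmorphM [conj_mx _ _ _]mxE; congr (_ * _).
exact/esym/conjc_real.
Qed.

End Forms.

(** * Null frames and the self-dual 2-forms *)

Lemma ord4P (P : 'I_4 -> Prop) :
  P 0 -> P 1 -> P 2%:R -> P 3%:R -> forall i, P i.
Proof.
move=> P0 P1 P2 P3 [[|[|[|[|//]]]] lt4].
- by rewrite (_ : Ordinal lt4 = 0) //; apply: val_inj.
- by rewrite (_ : Ordinal lt4 = 1) //; apply: val_inj.
- by rewrite (_ : Ordinal lt4 = 2%:R) //; apply: val_inj.
- by rewrite (_ : Ordinal lt4 = 3%:R) //; apply: val_inj.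
Qed.

Lemma dot_sym (K : comPzRingType) n (g : 'M[K]_n) u v :
  g^T = g -> dot g u v = dot g v u.
Proof.
move=> gs; rewrite /dot -[in LHS](trmxK (u *m g *m v^T)) [LHS]mxE.
by rewrite !trmx_mul trmxK gs mulmxA.
Qed.

Lemma tr_mul_rank1 (K : comNzRingType) n (u v x y : 'rV[K]_n) :
  \tr (u^T *m v *m (x^T *m y)) = (v *m x^T) 0 0 * (y *m u^T) 0 0.
Proof.
rewrite mulmxA mxtrace_mulC !mulmxA -(mulmxA (y *m u^T)) [LHS]big_ord_recl.
by rewrite big_ord0 addr0 mxE big_ord_recl big_ord0 addr0 mulrC.
Qed.

(** The four rank-one traces pair off into twice a 2 x 2 Gram determinant; the factor 2 cancels the
    1/2 of [ip]. *)
Lemma tr_skew_mul (K : comNzRingType) n (u v x y : 'rV[K]_n) :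
  \tr ((u^T *m v - v^T *m u)^T *m (x^T *m y - y^T *m x)) =
  2 * ((x *m u^T) 0 0 * (y *m v^T) 0 0 - (y *m u^T) 0 0 * (x *m v^T) 0 0).
Proof.
have dotC (w z : 'rV[K]_n) : (w *m z^T) 0 0 = (z *m w^T) 0 0.
  by rewrite -[in LHS](trmxK (w *m z^T)) [LHS]mxE trmx_mul trmxK.
have trB (A B : 'M[K]_n) : \tr (A - B) = \tr A - \tr B by exact: linearB.
rewrite [(_ - _)^T]linearB /= !trmx_mul !trmxK mulmxBl !mulmxBr !trB
  !tr_mul_rank1.
by rewrite (dotC v x) (dotC v y) (dotC u x) (dotC u y); ring.
Qed.

Section Wedge.
Variables (R : realType) (g : 'M[R]_4).
Hypotheses (gs : g^T = g) (gu : g \in unitmx).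
Local Notation G := (cplx_mx g).

Lemma cplx_mx_sym : G^T = G.
Proof. by rewrite -{2}gs /cplx_mx map_trmx. Qed.

Lemma raise_wedge (a b : 'rV[R[i]]_4) :
  raise g (wedge g a b) = a^T *m b - b^T *m a.
Proof.
have GG : cplx_mx (invmx g) *m G = 1%:M by rewrite -map_mxM mulVmx // map_mx1.
have GGT : G *m (cplx_mx (invmx g))^T = 1%:M.
  by rewrite -cplx_mx_sym -trmx_mul GG trmx1.
rewrite /raise /wedge mulmxBr mulmxBl !trmx_mul cplx_mx_sym !mulmxA GG !mul1mx.
by rewrite -!(mulmxA _ G) GGT !mulmx1.
Qed.

Lemma ip_wedge (a b c d : 'rV[R[i]]_4) :
  ip g (wedge g a b) (wedge g c d) = dot G a c * dot G b d - dot G a d * dot G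
    b c.
Proof.
have dotC x y : (x *m (y *m G)^T) 0 0 = dot G y x.
  by rewrite dot_sym ?cplx_mx_sym // /dot trmx_mul cplx_mx_sym mulmxA.
rewrite ip_tr raise_wedge /wedge tr_skew_mul !dotC mulKf //.
by rewrite pnatr_eq0.
Qed.

Lemma conj_wedge (a b : 'rV[R[i]]_4) :
  conj_mx (wedge g a b) = wedge g (conj_mx a) (conj_mx b).
Proof.
rewrite /wedge /conj_mx map_mxB !map_mxM -!map_trmx !map_mxM.
by rewrite -!/(conj_mx _) conj_cplx_mx.
Qed.

End Wedge.

Definition frame4 (K : nmodType) (a b c d : 'rV[K]_4) : 'M[K]_4 :=
  \matrix_p [:: a; b; c; d]`_p.

(** Writing X = E^T Y E with E the frame matrix, Y is skew as well, and its six entries above the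
    diagonal are the coefficients. *)
Lemma skew_frame_span (K : numFieldType) (a b c d : 'rV[K]_4) (X : 'M[K]_4) :
  frame4 a b c d \in unitmx -> X^T = - X ->
  let sk u v := u^T *m v - v^T *m u in
  exists y01 y02 y03 y12 y13 y23 : K,
    X = y01 *: sk a b + y02 *: sk a c + y03 *: sk a d + y12 *: sk b c
        + y13 *: sk b d + y23 *: sk c d.
Proof.
set E := frame4 a b c d => Eu Xs sk.
have ETu : E^T \in unitmx by rewrite unitmx_tr.
have [Y XE] : exists Y, X = E^T *m Y *m E.
  by exists (invmx E^T *m X *m invmx E); rewrite !mulmxA mulmxV // mul1mx
    mulmxKV.
have Ys : Y^T = - Y.
  apply: (can_inj (mulKmx ETu)); apply: (can_inj (mulmxK Eu)).
  by rewrite mulmxN mulNmx -XE -Xs XE !trmx_mul trmxK mulmxA.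
have YN p q : Y q p = - Y p q by have := congr1 (fun A : 'M_4 => A p q) Ys;
  rewrite !mxE.
have Y0 p : Y p p = 0.
  by apply/eqP; have /eqP := YN p p; rewrite -addr_eq0 -mulr2n mulrn_eq0.
exists (Y 0 1), (Y 0 2%:R), (Y 0 3%:R), (Y 1 2%:R), (Y 1 3%:R), (Y 2%:R 3%:R).
have E0 : row 0 E = a by rewrite rowK.
have E1 : row 1 E = b by rewrite rowK.
have E2 : row 2%:R E = c by rewrite rowK.
have E3 : row 3%:R E = d by rewrite rowK.
rewrite -E0 -E1 -E2 -E3 XE; clearbody E.
have sum4 (f : 'I_4 -> K) : \sum_i f i = f 0 + f 1 + f 2%:R + f 3%:R.
  rewrite !big_ord_recl big_ord0 addr0 !addrA.
  by congr (f _ + f _ + f _ + f _); apply: val_inj.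
have skE u v i j : sk u v i j = u 0 i * v 0 j - v 0 i * u 0 j.
  by rewrite /sk !mxE !big_ord_recl !big_ord0 !mxE !addr0.
apply/matrixP => i j.
have addE (A B : 'M[K]_4) : (A + B) i j = A i j + B i j by rewrite mxE.
have scaleE x (A : 'M[K]_4) : (x *: A) i j = x * A i j by rewrite mxE.
rewrite !addE !scaleE !skE.
rewrite mxE sum4 !mxE !sum4 !mxE !Y0.
rewrite (YN 0 1) (YN 0 2%:R) (YN 0 3%:R) (YN 1 2%:R) (YN 1 3%:R) (YN 2%:R 3%:R).
by ring.
Qed.

(** Here [n] stands for the conjugate of [m]: only the scalar products are kept, so that the algebra
    needs neither conjugation nor reality. *)
Record null_frame (K : comPzRingType) (g : 'M[K]_4) (l k m n : 'rV[K]_4) :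
  Prop :=
  NullFrame {
    null_frame_ll : dot g l l = 0; null_frame_kk : dot g k k = 0;
    null_frame_mm : dot g m m = 0; null_frame_nn : dot g n n = 0;
    null_frame_lk : dot g l k = -1; null_frame_mn : dot g m n = 1;
    null_frame_lm : dot g l m = 0; null_frame_ln : dot g l n = 0;
    null_frame_km : dot g k m = 0; null_frame_kn : dot g k n = 0 }.

Lemma frame4_mul (K : pzRingType) (a b c d : 'rV[K]_4) (B : 'M[K]_4) :
  frame4 (a *m B) (b *m B) (c *m B) (d *m B) = frame4 a b c d *m B.
Proof. by apply/row_matrixP; elim/ord4P; rewrite row_mul !rowK. Qed.

Lemma frame4_dot (K : comNzRingType) (G : 'M[K]_4) (a b c d : 'rV[K]_4) p q :
  let e (i : 'I_4) := [:: a; b; c; d]`_i in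
  (frame4 a b c d *m G *m (frame4 a b c d)^T) p q = dot G (e p) (e q).
Proof.
move=> e; rewrite -[RHS]/((e p *m G *m (e q)^T) 0 0).
have <- : row p (frame4 a b c d) = e p by rewrite rowK.
have <- : row q (frame4 a b c d) = e q by rewrite rowK.
by rewrite -row_mul mxE [RHS]mxE; apply: eq_bigr => j _; rewrite !mxE.
Qed.

(** The Gram matrix [Q] of the frame squares to 1, which exhibits a right inverse. Invertibility of
    the metric itself is also read off from this. *)
Lemma null_frame_unit (K : fieldType) (g : 'M[K]_4) (l k m n : 'rV[K]_4) :
  g^T = g -> null_frame g l k m n -> frame4 l k m n *m g \in unitmx.
Proof.
move=> gs [ll kk mm nn lk mn lm ln km kn].
pose Q : 'M[K]_4 := \matrix_(i, j)
  (nth [::] [:: [:: 0; -1; 0; 0]; [:: -1; 0; 0; 0]; [:: 0; 0; 0; 1]; [:: 0; 0;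
    1; 0]] i)`_j.
have EQ : frame4 l k m n *m g *m (frame4 l k m n)^T = Q.
  apply/matrixP; do 2!elim/ord4P; rewrite frame4_dot !mxE //=;
    by rewrite dot_sym.
have QQ : Q *m Q = 1%:M.
  apply/matrixP; do 2!elim/ord4P; rewrite !mxE !big_ord_recl big_ord0 !mxE /=;
    by ring.
have : frame4 l k m n *m g *m ((frame4 l k m n)^T *m Q) = 1%:M.
  by rewrite mulmxA EQ QQ.
by case/mulmx1_unit.
Qed.

Section Tetrad.
Variables (R : realType) (g : 'M[R]_4) (t l k : 'rV[R]_4) (m : 'rV[R[i]]_4).

Lemma null_tetrad_frame : null_tetrad g t l k m ->
  null_frame (cplx_mx g) (cplx_mx l) (cplx_mx k) m (conj_mx m).
Proof.
have dotE u v : dot (cplx_mx g) (cplx_mx u) (cplx_mx v) =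
  real_complex R (dot g u v).
  by rewrite /dot /cplx_mx map_trmx -!map_mxM mxE.
case=> [[_ _ ll kk lk] [mm nn mn] [lm ln] [km kn]].
split=> //; rewrite dotE ?ll ?kk ?lk ?rmorph0 //.
by rewrite rmorphN1.
Qed.

Hypothesis (gs : g^T = g).
Hypothesis tet : null_tetrad g t l k m.

Lemma null_tetrad_unit : frame4 (cplx_mx l) (cplx_mx k) m (conj_mx m) *m
  cplx_mx g \in unitmx.
Proof. exact: null_frame_unit (cplx_mx_sym gs) (null_tetrad_frame tet). Qed.

Lemma null_tetrad_metric_unit : g \in unitmx.
Proof.
by have := null_tetrad_unit; rewrite unitmx_mul map_unitmx => /andP [].
Qed.

End Tetrad.

Definition bivec3 (K : nmodType) (U W V : 'M[K]_4) (p : 'I_3) : 'M[K]_4 :=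
  [:: U; W; V]`_p.

Section Base.
Variables (R : realType) (g : 'M[R]_4) (o : bool) (t : 'rV[R]_4).
Variables (W U V : 'M[R[i]]_4).
Hypotheses (gs : g^T = g) (base : null_bivector_base g o t W U V).

Lemma null_bivector_gram p q :
  ip g (bivec3 U W V p) (bivec3 U W V q) = gram3 _ p q.
Proof.
case: base => l [k [m [tet WE UE VE _]]].
have gu := null_tetrad_metric_unit gs tet.
have [] := null_tetrad_frame tet.
move: WE UE VE; set L := cplx_mx l; set N := cplx_mx k; set n := conj_mx m.
set G := cplx_mx g.
move=> WE UE VE ll kk mm nn lk mn lm ln km kn.
have Gs : G^T = G := cplx_mx_sym gs.
have kl : dot G N L = -1 by rewrite dot_sym.
have nm : dot G n m = 1 by rewrite dot_sym.
have ml : dot G m L = 0 by rewrite dot_sym.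
have nl : dot G n L = 0 by rewrite dot_sym.
have mk : dot G m N = 0 by rewrite dot_sym.
have nk : dot G n N = 0 by rewrite dot_sym.
have s22 : (sqrtC 2)^-1 * (sqrtC 2)^-1 = 2^-1 :> R[i].
  by rewrite -invfM -expr2 sqrtCK.
(* Only the products of wedges matter from here on, so [wedge g] is made opaque before the nine
   cases are computed. *)
have := ip_wedge gs gu; rewrite -/G; move: (wedge g) WE UE VE => w WE UE VE ipw.
elim/ord3P: p; elim/ord3P: q; rewrite !mxE /bivec3 /= ?WE ?UE ?VE;
  rewrite !ipZl !ipZr ?ipDl ?ipDr; rewrite !ipw;
  rewrite ?(ll, kk, mm, nn, lk, mn, lm, ln, km, kn, kl, nm, ml, nl, mk, nk);
  rewrite !mulrA ?mulNr ?mulrN s22; by field.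
Qed.

End Base.

Lemma self_dual_sum (R : realType) (g : 'M[R]_4) o n (x : 'I_n -> R[i]) F :
  (forall p, self_dual g o (F p)) -> self_dual g o (\sum_p x p *: F p).
Proof.
move=> Fsd; split.
  rewrite linear_sum -sumrN; apply: eq_bigr => p _.
  by rewrite linearZ /= (proj1 (Fsd p)) scalerN.
rewrite linear_sum scaler_sumr; apply: eq_bigr => p _.
by rewrite linearZ /= (proj2 (Fsd p)) !scalerA mulrC.
Qed.

Lemma sum_bivec3 (R : realType) (U W V : 'M[R[i]]_4) (x : 'rV[R[i]]_3) :
  \sum_p x 0 p *: bivec3 U W V p = x 0 0 *: U + x 0 1 *: W + x 0 2%:R *: V.
Proof.
rewrite !big_ord_recl big_ord0 addr0 addrA /bivec3 /=.
by congr (_ *: _ + x _ _ *: _ + x _ _ *: _); apply: val_inj.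
Qed.

Lemma null_bivector_self_dual (R : realType) (g : 'M[R]_4) o t (U W V :
  'M[R[i]]_4) p :
  null_bivector_base g o t W U V -> self_dual g o (bivec3 U W V p).
Proof. by case=> l [k [m [_ _ _ _ [Ws Us Vs]]]]; elim/ord3P: p. Qed.

Lemma conj_mxZ (R : realType) m n a (X : 'M[R[i]]_(m, n)) :
  conj_mx (a *: X) = Num.conj a *: conj_mx X.
Proof. exact: map_mxZ. Qed.

Lemma hodge_conj_self_dual (R : realType) (g : 'M[R]_4) o X :
  self_dual g o X -> hodge g o (conj_mx X) = - 'i *: conj_mx X.
Proof. by case=> _ Xd; rewrite hodge_conj Xd conj_mxZ conjCi. Qed.

Lemma conj_mxD (R : realType) m n (X Y : 'M[R[i]]_(m, n)) :
  conj_mx (X + Y) = conj_mx X + conj_mx Y.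
Proof. exact: map_mxD. Qed.

(** In the application [s] is the square root of 2, [a], ..., [f] are the wedges lk, lm, ln, km, kn,
    mn with n the conjugate of m, and [U'], [W'], [V'] are the conjugates of [U], [W], [V]. *)
Lemma null_bivector_change (K : numFieldType) n (s y01 y02 y03 y12 y13 y23 : K)
    (a b c d e f U W V U' W' V' X : 'M[K]_n) : s != 0 ->
  U = - s^-1 *: c -> W = s^-1 *: (a + f) -> V = s^-1 *: d ->
  U' = - s^-1 *: b -> W' = s^-1 *: (a - f) -> V' = s^-1 *: e ->
  X = y01 *: a + y02 *: b + y03 *: c + y12 *: d + y13 *: e + y23 *: f ->
  X = (- s * y03) *: U + (s * (y01 + y23) / 2) *: W + (s * y12) *: V
  + ((- s * y02) *: U' + (s * (y01 - y23) / 2) *: W' + (s * y13) *: V').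
Proof.
by move=> s0 -> -> -> -> -> -> ->; apply/matrixP => i j; rewrite !mxE; field.
Qed.

(** Comparing the two values of [f (Y + Z)] leaves - c Z = c Z. This removes the anti-self-dual part
    of a self-dual form. *)
Lemma eigen_summand (K : numFieldType) (V : lmodType K) (f : {linear V ->
  V}) (c : K) (Y Z : V) :
  c != 0 -> f Y = c *: Y -> f Z = - c *: Z -> f (Y + Z) = c *: (Y + Z) -> Z = 0.
Proof.
move=> c0 fY fZ; rewrite linearD fY fZ scalerDr => /addrI /eqP.
rewrite eq_sym -subr_eq0 -scalerBl opprK scaler_eq0 -mulr2n mulrn_eq0 /=
  (negbTE c0) /=.
by move/eqP.
Qed.

Lemma eigen_linear3 (K : numFieldType) (V : lmodType K) (f : {linear V ->
  V}) (c x y z : K) u v w :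
  f u = c *: u -> f v = c *: v -> f w = c *: w ->
  f (x *: u + y *: v + z *: w) = c *: (x *: u + y *: v + z *: w).
Proof.
by move=> fu fv fw; rewrite !linearD !linearZ /= fu fv fw !scalerA ![_ *
  c]mulrC.
Qed.

Lemma null_bivector_span (R : realType) (g : 'M[R]_4) o t (U W V : 'M[R[i]]_4)
  X :
  g^T = g -> null_bivector_base g o t W U V -> self_dual g o X ->
  exists x : 'rV_3, X = \sum_p x 0 p *: bivec3 U W V p.
Proof.
move=> gs base [Xs Xd].
have sdF := null_bivector_self_dual _ base.
case: base => l [k [m [tet WE UE VE _]]].
(* The frame consists of the lowered tetrad vectors, so its skew products are the six wedges of the
   tetrad. *)
have := null_tetrad_unit gs tet; rewrite -frame4_mul => /skew_frame_span /(_
  Xs).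
pose s : R[i] := sqrtC 2; rewrite -/s in WE UE VE.
have s0 : s != 0 by rewrite sqrtC_eq0 pnatr_eq0.
have sJ : Num.conj s = s by rewrite geC0_conj // sqrtC_ge0 ler0n.
clearbody s.
case=> y01 [y02 [y03 [y12 [y13 [y23]]]]].
set L := cplx_mx l in WE UE *; set N := cplx_mx k in WE VE *;
  set n := conj_mx m in WE UE *.
rewrite -/(X = y01 *: wedge g L N + y02 *: wedge g L m + y03 *: wedge g L n
  + y12 *: wedge g N m + y13 *: wedge g N n + y23 *: wedge g m n) => XE.
pose x : 'rV[R[i]]_3 := rv3 (- s * y03) (s * (y01 + y23) / 2) (s * y12).
have nJ : conj_mx n = m by apply/matrixP => i j; rewrite !mxE conjCK.
have LJ : conj_mx L = L := conj_cplx_mx l.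
have NJ : conj_mx N = N := conj_cplx_mx k.
have sVJ : Num.conj s^-1 = s^-1 by rewrite fmorphV /= sJ.
have sNJ : Num.conj (- s^-1) = - s^-1 by rewrite rmorphN /= sVJ.
have UJ : conj_mx U = - s^-1 *: wedge g L m.
  rewrite UE conj_mxZ sNJ conj_wedge LJ nJ; congr (_ *: _).
have VJ : conj_mx V = s^-1 *: wedge g N n.
  rewrite VE conj_mxZ conj_wedge NJ sVJ; congr (_ *: _).
have WJ : conj_mx W = s^-1 *: (wedge g L N - wedge g m n).
  rewrite WE conj_mxZ conj_mxD !conj_wedge.
  rewrite LJ NJ sVJ nJ -/n [wedge g n m]/wedge -opprB; congr (_ *: _).
have Ud := hodge_conj_self_dual (sdF 0).
have Wd := hodge_conj_self_dual (sdF 1).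
have Vd := hodge_conj_self_dual (sdF 2%:R).
have {}XE := null_bivector_change s0 UE WE VE UJ WJ VJ XE.
have xE := sum_bivec3 U W V x; rewrite !mxE /= in xE.
rewrite -xE in XE.
exists x; have [_ Yd] := self_dual_sum (fun p => x 0 p) sdF.
rewrite XE (eigen_summand (neq0Ci _) Yd (eigen_linear3 _ _ _ Ud Wd Vd)) ?addr0
  //.
by rewrite -XE.
Qed.

(** * The endomorphism of a tensor spanned by a frame *)

Section Frame.
Variables (R : realType) (g : 'M[R]_4) (n : nat).
Variables (F : 'I_n -> 'M[R[i]]_4) (G S : 'M[R[i]]_n) (T : tensor4 R[i]).
Hypothesis gramF : forall p q, ip g (F p) (F q) = G p q.
Hypothesis TE : forall a b c d,
  T a b c d = \sum_p \sum_q S p q * tens (F p) (F q) a b c d.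

Lemma ip_frame (x y : 'rV[R[i]]_n) :
  ip g (\sum_p x 0 p *: F p) (\sum_p y 0 p *: F p) = (x *m G *m y^T) 0 0.
Proof.
rewrite ip_sumZr mxE; apply: eq_bigr => q _.
rewrite ip_sumZl !mxE mulrC; congr (_ * _); apply: eq_bigr => p _.
by rewrite gramF.
Qed.

Lemma frame_free (x y : 'rV[R[i]]_n) : G \in unitmx ->
  \sum_p x 0 p *: F p = \sum_p y 0 p *: F p -> x = y.
Proof.
move=> Gu xy; apply: (can_inj (mulmxK Gu)); apply/rowP => q.
have := congr1 (fun X => ip g X (F q)) xy; rewrite !ip_sumZl !mxE.
by under eq_bigr do rewrite gramF; under [in RHS]eq_bigr do rewrite gramF.
Qed.

Definition frame_coords (X : 'M[R[i]]_4) : 'rV[R[i]]_n :=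
  \row_p \sum_q S p q * ip g (F q) X.

Lemma frame_coords_linear : linear frame_coords.
Proof.
move=> a X Y; apply/rowP => p; rewrite !mxE mulr_sumr -big_split.
by apply: eq_bigr => q _; rewrite /= ipDr ipZr mulrDr mulrCA.
Qed.

HB.instance Definition _ :=
  GRing.isLinear.Build R[i] 'M[R[i]]_4 'rV[R[i]]_n _ frame_coords
    frame_coords_linear.

Lemma endo_frame X : endo g T X = \sum_p frame_coords X 0 p *: F p.
Proof.
apply/matrixP => a b; rewrite mxE summxE.
have -> : (\matrix_(c, d) T a b c d) = \sum_p F p a b *: \sum_q S p q *: F q.
  apply/matrixP => c d; rewrite mxE TE summxE; apply: eq_bigr => p _.
  rewrite mxE summxE mulr_sumr; apply: eq_bigr => q _.
  by rewrite mxE /tens mulrCA.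
rewrite ip_sumZl; apply: eq_bigr => p _.
by rewrite ip_sumZl !mxE mulrC.
Qed.

Lemma frame_coords_sum (x : 'rV[R[i]]_n) :
  frame_coords (\sum_p x 0 p *: F p) = x *m (S *m G)^T.
Proof.
apply/rowP => p; rewrite !mxE.
under [RHS]eq_bigr do rewrite !mxE mulr_sumr.
rewrite exchange_big; apply: eq_bigr => q _ /=.
rewrite ip_sumZr mulr_sumr; apply: eq_bigr => r _.
by rewrite gramF mulrCA.
Qed.

(** [Q] sends a tensor to the coordinates of its image and [Fm] sends coordinates back to tensors:
    the endomorphism is [Q *m Fm] on all 2-tensors and [Fm *m Q] on coordinates. *)
Let Q : 'M[R[i]]_(4 * 4, n) := lin1_mx (frame_coords \o vec_mx).
Let Fm : 'M[R[i]]_(n, 4 * 4) := \matrix_p mxvec (F p).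

Let mxvec_endo X : mxvec (endo g T X) = mxvec X *m (Q *m Fm).
Proof.
rewrite mulmxA mul_rV_lin1 /= mxvecK mulmx_sum_row endo_frame linear_sum.
by apply: eq_bigr => p _; rewrite linearZ rowK.
Qed.

Let FmQ : Fm *m Q = (S *m G)^T.
Proof.
apply/row_matrixP => p; rewrite row_mul rowK mul_rV_lin1 /= mxvecK rowE.
rewrite -frame_coords_sum; congr frame_coords.
rewrite (bigD1 p) //= big1 ?addr0 => [|q qp]; rewrite mxE eqxx.
  by rewrite eqxx scale1r.
by rewrite (negbTE qp) scale0r.
Qed.

(** Cyclicity of the trace replaces powers of [Q *m Fm] by powers of [Fm *m Q], reducing a trace
    over all 2-tensors to one in coordinates. *)
Lemma invariant_I_frame :
  invariant_I g T = 2^-1 * \tr ((S *m G)^T *m (S *m G)^T).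
Proof.
rewrite /invariant_I (@lin_mxP _ _ _ _ _ _ (Q *m Fm *m (Q *m Fm))).
  by rewrite -FmQ -mulmxA mxtrace_mulC !mulmxA.
by move=> X; rewrite /= !mxvec_endo !mulmxA.
Qed.

Lemma invariant_J_frame :
  invariant_J g T = 6^-1 * \tr ((S *m G)^T *m (S *m G)^T *m (S *m G)^T).
Proof.
rewrite /invariant_J (@lin_mxP _ _ _ _ _ _ (Q *m Fm *m (Q *m Fm) *m (Q *m Fm))).
  by rewrite -FmQ -!mulmxA mxtrace_mulC !mulmxA.
by move=> X; rewrite /= !mxvec_endo !mulmxA.
Qed.

End Frame.

(** * Principal 2-forms *)

Lemma mulmx_row_entry (K : comNzRingType) n (N G : 'M[K]_n) i j :
  (row i N *m G *m (row j N)^T) 0 0 = (N *m G *m N^T) i j.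
Proof. by rewrite -row_mul mxE [RHS]mxE; apply: eq_bigr => k _;
  rewrite !mxE. Qed.

Lemma row_mul_diag (K : fieldType) n (al : 'I_n -> K) (N : 'M[K]_n) i :
  row i (diag_mx (\row_k al k) *m N) = al i *: row i N.
Proof. by apply/rowP => j; rewrite mxE mul_diag_entry !mxE. Qed.

Lemma gram3_unit (K : numFieldType) : gram3 K \in unitmx.
Proof.
suff /mulmx1_unit [] : gram3 K *m mx3 [:: [:: 0; 0; 2]; [:: 0; -1; 0]; [:: 2;
  0; 0]] = 1%:M by [].
apply/matrixP; do 2!elim/ord3P; rewrite !mxE !big_ord_recl big_ord0 !mxE /=;
  by field.
Qed.

Lemma weyl3_principal_rows (K : numFieldType) (p0 p1 p2 p3 p4 : K) (al s :
  'I_3 -> K) :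
  let M := (weyl3 p0 p1 p2 p3 p4 *m gram3 K)^T in
  let A i := eigA p0 p1 p2 p3 p4 (al i) in
  let B i := eigB p1 p2 p3 p4 (al i) in
  let C i := eigC p2 p3 p4 (al i) in
  let D i := eigD p0 p1 p2 p3 p4 (al i) in
  injective al ->
  (forall i, al i ^+ 3 = weyl_I p0 p1 p2 p3 p4 * al i + 2 * weyl_J p0 p1 p2 p3
    p4) ->
  (forall i, D i != 0) -> (forall i, s i ^+ 2 = D i * C i) ->
  exists N : 'M[K]_3,
    [/\ N *m gram3 K *m N^T = - 1%:M, N *m M = diag_mx (\row_k al k) *m N
      & forall i, C i != 0 -> row i N = (s i)^-1 *: rv3 (A i) (B i) (C i)].
Proof.
move=> M A B C D alI rt D0 sDC.
(* When [C i = 0] also [s i = 0], and the formula gives no unit row; the eigenrow obtained from W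
   takes its place. *)
pose x i := if C i == 0 then rv3 (- eigA' p0 p1 p2 p3 (al i) / (2 * D i)) 1 0
            else (s i)^-1 *: rv3 (A i) (B i) (C i).
pose N : 'M[K]_3 := \matrix_i x i.
have NM : N *m M = diag_mx (\row_k al k) *m N.
  apply/row_matrixP => i; rewrite row_mul row_mul_diag !rowK /x.
  case: eqP => C0; first exact: weyl3_eigenrow0 (rt i) C0 (D0 i).
  by rewrite -scalemxAl weyl3_eigenrow // !scalerA mulrC.
exists N; split=> // [|i C0]; last by rewrite rowK /x (negbTE C0).
apply/matrixP => i j; rewrite [RHS]mxE [X in - X]mxE.
have [<-|nij] := eqVneq i j; last first.
  rewrite oppr0; apply: (eigenrows_orthogonal alI (gram3_tr K) _ NM) => //.
  by rewrite /M !trmx_mul !trmxK gram3_tr weyl3_tr mulmxA.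
rewrite -[LHS]mulmx_row_entry rowK /x; case: eqP => [C0|/eqP C0].
  by rewrite gram3_rv3 mxE eqxx mulr0 expr1n sub0r.
have s0 : s i != 0 by rewrite -sqrf_eq0 sDC mulf_neq0.
rewrite linearZ /= -!scalemxAl -scalemxAr scalerA gram3_rv3 !mxE eqxx.
(* The square norm is (A C - B^2) / s^2 = - D C / s^2 = -1. *)
rewrite eigABC_norm // -/(D i) -/(C i) -sDC !mulr1n.
by field.
Qed.

Section PrincipalForms.
Variables (R : realType) (g : 'M[R]_4) (o : bool) (t : 'rV[R]_4).
Variables (T : tensor4 R[i]) (W U V : 'M[R[i]]_4) (p0 p1 p2 p3 p4 : R[i]).
Hypotheses (gs : g^T = g) (base : null_bivector_base g o t W U V).
Hypothesis comp : weyl_components T W U V p0 p1 p2 p3 p4.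

Local Notation S := (weyl3 p0 p1 p2 p3 p4).
Local Notation F := (bivec3 U W V).

Lemma weyl_components_frame a b c d :
  T a b c d = \sum_p \sum_q S p q * tens (F p) (F q) a b c d.
Proof.
rewrite -[LHS](mulVKf (_ : 2 != 0)) ?pnatr_eq0 // comp.
rewrite !big_ord_recl !big_ord0 !mxE /bivec3 /symtens /=; ring.
Qed.

(** The traces of M^2 and M^3 in the base identify the invariants of [T] with the polynomials I and
    J in the components. *)
Lemma type_I_cubic : type_I g T -> exists2 r : 'I_3 -> R[i], injective r &
  forall i, r i ^+ 3 - weyl_I p0 p1 p2 p3 p4 * r i
            - 2 * weyl_J p0 p1 p2 p3 p4 = 0.
Proof.
have gr := null_bivector_gram gs base; have TE := weyl_components_frame.
have IE : invariant_I g T = weyl_I p0 p1 p2 p3 p4.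
  by rewrite (invariant_I_frame gr TE) tr_weyl3_sqr mulKf // pnatr_eq0.
have JE : invariant_J g T = weyl_J p0 p1 p2 p3 p4.
  by rewrite (invariant_J_frame gr TE) tr_weyl3_cube mulKf // pnatr_eq0.
case=> r rI rr; exists r => // i; have /rootP := rr i.
by rewrite /characteristic_poly IE JE !hornerE.
Qed.

(** Taking coordinates in (U, W, V) turns [ip] into [gram3] and [endo g T] into the matrix M, so
    each clause becomes a matrix identity for [N]. *)
Lemma principal_rows_2forms (al : 'I_3 -> R[i]) (N : 'M[R[i]]_3) :
  injective al -> N *m gram3 _ *m N^T = - 1%:M ->
  N *m (S *m gram3 _)^T = diag_mx (\row_k al k) *m N ->
  let Wp i := \sum_p N i p *: F p in
  principal_2forms g o T al Wp /\
  forall Wp', principal_2forms g o T al Wp' ->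
    forall i, Wp' i = Wp i \/ Wp' i = - Wp i.
Proof.
move=> alI NG NM Wp.
have gr := null_bivector_gram gs base; have TE := weyl_components_frame.
have WpE i : Wp i = \sum_p row i N 0 p *: F p.
  by apply: eq_bigr => p _; rewrite mxE.
have endoE (x : 'rV_3) : endo g T (\sum_p x 0 p *: F p) =
    \sum_p (x *m (S *m gram3 _)^T) 0 p *: F p.
  by rewrite (endo_frame _ TE) (frame_coords_sum _ gr).
have scaleE a (x : 'rV_3) : a *: (\sum_p x 0 p *: F p) =
  \sum_p (a *: x) 0 p *: F p.
  by rewrite scaler_sumr; apply: eq_bigr => p _; rewrite scalerA mxE.
have ipWp i j : ip g (Wp i) (Wp j) = (- 1%:M : 'M_3) i j.
  by rewrite !WpE (ip_frame gr) mulmx_row_entry NG.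
split.
  split.
  - move=> i; apply: self_dual_sum => p; exact: null_bivector_self_dual base.
  - by move=> i; rewrite ipWp !mxE eqxx.
  - by move=> i j nij; rewrite ipWp !mxE (negbTE nij) oppr0.
  - by move=> i; rewrite WpE endoE -row_mul NM row_mul_diag scaleE.
  - move=> a b c d; rewrite TE (spectral_decomposition NG NM).
    have sumE (X : 'I_3 -> 'M[R[i]]_4) i j : (\sum_p X p) i j =
      \sum_p X p i j by rewrite summxE.
    under [in RHS]eq_bigr => i _.
      rewrite /tens !sumE big_distrlr /= mulr_sumr.
      under eq_bigr do rewrite mulr_sumr.
      over.
    rewrite [X in _ = - X]exchange_big -sumrN; apply: eq_bigr => p _.
    rewrite [X in _ = - X]exchange_big -sumrN; apply: eq_bigr => q _.
    rewrite -mulmxA !mxE mulNr mulr_suml; congr (- _); apply: eq_bigr => i _.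
    rewrite mul_diag_entry !mxE /tens; ring.
move=> Wp' [sd' nrm' _ eig' _] i.
(* A competing form is self-dual, hence has coordinates [x]; these form a unit eigenrow, to which
   uniqueness of rows applies. *)
have [x xE] := null_bivector_span gs base (sd' i).
have xM : x *m (S *m gram3 _)^T = al i *: x.
  apply: (frame_free gr (gram3_unit _)); by rewrite -endoE -scaleE -xE eig'.
have xG : x *m gram3 _ *m x^T = - 1%:M.
  apply/matrixP => j k; rewrite !ord1 -(ip_frame gr) -xE nrm' !mxE eqxx //.
case: (unit_eigenrow_uniq alI NG NM xM xG) => xN; [left|right].
  by rewrite xE xN WpE.
by rewrite xE xN WpE -scaleN1r -scaleE scaleN1r.
Qed.

End PrincipalForms.

(* r is either square root of J^2 - I^3/27, beta any non-zero cube root of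
   J + r, and s i either square root of D_i C_i.  When C_i = 0, which a non
   transverse base does not exclude, A_i = B_i = 0 as well and the formula for
   W_i is 0/0; it is asserted for every i with C_i != 0. *)
Theorem theorem2 (R : realType) (g : 'M[R]_4) (o : bool) (t : 'rV[R]_4)
    (C : tensor4 R) (W U V : 'M[R[i]]_4) (Psi0 Psi1 Psi2 Psi3 Psi4 : R[i]) :
  lorentzian g ->
  dot g t t < 0 ->
  weyl_tensor g C ->
  type_I g (self_dual_weyl g o C) ->
  null_bivector_base g o t W U V ->
  weyl_components (self_dual_weyl g o C) W U V Psi0 Psi1 Psi2 Psi3 Psi4 ->
  ~ transverse Psi1 Psi3 ->
  let I := Psi0 * Psi4 - 4 * Psi1 * Psi3 + 3 * Psi2 ^+ 2 in
  let J := \det (\matrix_(i < 3, j < 3)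
                   tnth (tnth [tuple [tuple Psi4; Psi3; Psi2];
                                     [tuple Psi3; Psi2; Psi1];
                                     [tuple Psi2; Psi1; Psi0]] i) j) in
  forall r beta : R[i],
  r ^+ 2 = J ^+ 2 - I ^+ 3 / 27 ->
  beta ^+ 3 = J + r ->
  beta != 0 ->
  let alpha := fun i : 'I_3 =>
    [:: beta + I / (3 * beta);
        - 2^-1 * ((1 - 'i * sqrtC 3) * beta
                  + (1 + 'i * sqrtC 3) * (I / (3 * beta)));
        - 2^-1 * ((1 + 'i * sqrtC 3) * beta
                  + (1 - 'i * sqrtC 3) * (I / (3 * beta)))]`_i in
  let A := fun i : 'I_3 =>
    Psi0 * Psi4 + Psi2 ^+ 2 - 2 * Psi1 * Psi3 + alpha i * Psi2
    + (alpha i ^+ 2 - I) in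
  let B := fun i : 'I_3 => Psi1 * Psi4 - Psi2 * Psi3 + Psi3 * alpha i in
  let Cc := fun i : 'I_3 =>
    2 * Psi2 * Psi4 - 2 * Psi3 ^+ 2 + alpha i * Psi4 in
  let D := fun i : 'I_3 => 2^-1 * (I - 3 * alpha i ^+ 2) in
  forall s : 'I_3 -> R[i],
  (forall i, s i ^+ 2 = D i * Cc i) ->
  exists Wp : 'I_3 -> 'M[R[i]]_4,
    [/\ principal_2forms g o (self_dual_weyl g o C) alpha Wp,
        forall i, Cc i != 0 ->
          Wp i = (s i)^-1 *: (A i *: U + B i *: W + Cc i *: V)
      & forall Wp' : 'I_3 -> 'M[R[i]]_4,
          principal_2forms g o (self_dual_weyl g o C) alpha Wp' ->
          forall i, Wp' i = Wp i \/ Wp' i = - Wp i].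
Proof.
move=> glor _ _ tI base comp _ I J r beta rr bb b0 alpha A B Cc D s sDC.
have gs := lorentzian_sym glor.
have JE : J = weyl_J Psi0 Psi1 Psi2 Psi3 Psi4 by exact: det_weyl_J.
have cc : ('i * sqrtC 3 : R[i]) ^+ 2 = - 3 by rewrite exprMn sqrCi sqrtCK mulN1r.
have [rts rtsI rtsE] := type_I_cubic gs base comp tI.
(* Type I provides three distinct roots of the cubic, and Cardano's values exhaust its roots. *)
have alI : injective alpha.
  by apply: (cardano_inj cc rr bb b0 rtsI) => i; rewrite JE; apply: rtsE.
have alE i : alpha i ^+ 3 = I * alpha i + 2 * weyl_J Psi0 Psi1 Psi2 Psi3 Psi4.
  by rewrite -JE; exact: cardano_root cc rr bb b0 i.
have D0 i : D i != 0.
  rewrite mulf_neq0 ?invr_eq0 ?pnatr_eq0 // -opprB oppr_eq0.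
  rewrite (cardano_disc _ cc b0 i); apply/prodf_neq0 => j nji.
  by rewrite subr_eq0; apply: contraNneq nji => /alI ->.
have [N [NG NM NE]] := weyl3_principal_rows alI alE D0 sDC.
have [prin uniq] := principal_rows_2forms gs base comp alI NG NM.
exists (fun i => \sum_p N i p *: bivec3 U W V p); split=> // i Ci0.
have -> : \sum_p N i p *: bivec3 U W V p = \sum_p row i N 0 p *: bivec3 U W V p.
  by apply: eq_bigr => p _; rewrite mxE.
by rewrite (NE i Ci0) sum_bivec3 !mxE /= !scalerDr !scalerA.
Qed.
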